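(* Let $X$ be a locally complete, webbed and ultrabornological locally convex Hausdorff space. Let $T\in\mathcal{L}(X)$ be a compact operator such that $1\in\sigma(T;X)$ with $\sigma(T;X)\setminus\{1\}\subseteq\overline{B(0,\delta)}$ for some $\delta\in(0,1)$, and satisfying $\mathrm{Ker}(I-T)\cap(I-T)(X)=\{0\}$. Then $T$ is both power bounded and uniformly mean ergodic.
   Context: All spaces are over $\mathbb{C}$. For a locally convex Hausdorff space $X$: $\mathcal{L}(X)$ is the space of continuous linear operators on $X$; $\mathcal{L}_b(X)$ is $\mathcal{L}(X)$ with the topology of uniform convergence on bounded subsets of $X$. $X$ is locally complete if, for each closed, absolutely convex, bounded set $B\subseteq X$, the space $X_B:=\mathrm{span}(B)$ equipped with the Minkowski functional of $B$ is a Banach space. $X$ is ultrabornological if it is an inductive limit of Banach spaces. $X$ is webbed if it admits a web (in the sense of De Wilde): a family of absolutely convex sets $C_{n_1,\dots,n_k}\subseteq X$ ($k\in\mathbb{N}$, $n_1,\dots,n_k\in\mathbb{N}$) with $\bigcup_nC_n=X$, $\bigcup_nC_{n_1,\dots,n_k,n}=C_{n_1,\dots,n_k}$, and such that for every sequence $(n_k)_k$ in $\mathbb{N}$ there are $\lambda_k>0$ such that $\sum_k\lambda_kx_k$ converges in $X$ whenever $x_k\in C_{n_1,\dots,n_k}$ for all $k$. $T:X\to X$ linear is compact if there is a neighbourhood $\mathcal{U}$ of $0$ with $T(\mathcal{U})$ relatively compact in $X$. For $T\in\mathcal{L}(X)$, $\sigma(T;X)$ is the set of $\lambda\in\mathbb{C}$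 for which $\lambda I-T$ has no inverse in $\mathcal{L}(X)$. $B(0,\delta):=\{z\in\mathbb{C}:|z|<\delta\}$. $T$ is power bounded if $\{T^n:n\in\mathbb{N}\}$ is equicontinuous, and uniformly mean ergodic if the sequence $T_{[n]}:=\frac1n\sum_{m=1}^nT^m$, $n\in\mathbb{N}$, converges in $\mathcal{L}_b(X)$. *)

(* Defs.v *)
From HB Require Import structures.
From mathcomp Require Export all_boot all_order all_algebra.
From mathcomp Require Export all_classical all_reals all_analysis.
From mathcomp Require Export complex.
Set Implicit Arguments.
Unset Strict Implicit.
Unset Printing Implicit Defensive.
Export Order.TTheory GRing.Theory Num.Theory.
Export numFieldNormedType.Exports.

Local Open Scope classical_set_scope.
Local Open Scope ring_scope.
Local Open Scope complex_scope.

Section LocallyConvexSpaces.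
Context {R : realType} {X : tvsType R[i]}.

Definition absolutely_convex (A : set X) : Prop :=
  convex_set A /\ forall (a : R[i]) x, `|a| <= 1 -> A x -> A (a *: x).

(** Von Neumann boundedness: absorption by every neighbourhood of [0]. *)
Definition tvs_bounded (B : set X) : Prop :=
  forall V : set X, nbhs 0 V ->
    exists2 r : R, 0 < r & B `<=` [set r%:C *: v | v in V].

Definition linear_span (B : set X) : set X :=
  [set x | exists n (a : 'I_n -> R[i]) (b : 'I_n -> X),
     (forall i, B (b i)) /\ x = \sum_(i < n) a i *: b i].

Definition minkowski (B : set X) (x : X) : R :=
  inf [set t : R | 0 < t /\ [set t%:C *: b | b in B] x].

(** The restriction of [p] to the linear subspace [E] is a complete norm. The
    values of [p] outside [E] are irrelevant. *)
Definition banach_subspace (E : set X) (p : X -> R) : Prop :=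
  [/\ [/\ E 0, forall x y, E x -> E y -> E (x + y)
        & forall (a : R[i]) x, E x -> E (a *: x)],
      [/\ forall x, E x -> 0 <= p x,
          forall x, E x -> p x = 0 -> x = 0,
          forall x y, E x -> E y -> p (x + y) <= p x + p y
        & forall (a : R[i]) x, E x -> (p (a *: x))%:C = `|a| * (p x)%:C]
    & forall u : nat -> X, (forall n, E (u n)) ->
        (forall e : R, 0 < e ->
           exists N, forall m n, (N <= m)%N -> (N <= n)%N ->
             p (u m - u n) < e) ->
        exists2 l, E l & p (u n - l) @[n --> \oo] --> (0 : R)].

Definition locally_complete : Prop :=
  forall B : set X, closed B -> absolutely_convex B -> tvs_bounded B ->
    banach_subspace (linear_span B) (minkowski B).

(** [X] is spanned by the images of a family of Banach spaces and carries the
    finest locally convex topology that makes the maps continuous. Testing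
    against linear maps [g] into arbitrary locally convex spaces [Y] is the
    same as comparing with arbitrary locally convex topologies on [X]: take
    [g] the identity in one direction, pull back the topology of [Y] along [g]
    in the other. *)
Definition ultrabornological : Prop :=
  exists (I : Type) (E : I -> completeNormedModType R[i])
         (f : forall i, {linear E i -> X}),
    [/\ forall i, continuous (f i),
        linear_span (\bigcup_i range (f i)) = setT
      & forall (Y : tvsType R[i]) (g : {linear X -> Y}),
          (forall i, continuous (g \o f i)) -> continuous g].

(** [C [:: n_1; ...; n_k]] is the set $C_{n_1,...,n_k}$, for [k] at least 1;
    [C [::]] is unused. *)
Definition is_web (C : seq nat -> set X) : Prop :=
  [/\ forall s, s != [::] -> absolutely_convex (C s),
      \bigcup_n C [:: n] = setT,
      forall s, s != [::] -> \bigcup_n C (rcons s n) = C s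
    & forall n : nat -> nat, exists2 lambda : nat -> R,
        (forall k, 0 < lambda k)
        & forall x : nat -> X, (forall k, C (mkseq n k.+1) (x k)) ->
            exists l : X, series (fun k => (lambda k)%:C *: x k) @ \oo --> l].

Definition webbed : Prop := exists C : seq nat -> set X, is_web C.

Definition compact_operator (T : X -> X) : Prop :=
  exists2 U : set X, nbhs 0 U & precompact (T @` U).

(** An inverse of [lambda I - T] in the algebra of continuous linear
    operators. *)
Definition resolvent_at (T : X -> X) (lambda : R[i]) (S : {linear X -> X}) :
    Prop :=
  [/\ continuous S, cancel (fun x => lambda *: x - T x) S
    & cancel S (fun x => lambda *: x - T x)].

Definition spectrum (T : X -> X) : set R[i] :=
  [set lambda | ~ exists S : {linear X -> X}, resolvent_at T lambda S].

(** Equicontinuity for the uniformity of the topological vector space, whose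
    entourages are the sets [[set xy | V (xy.2 - xy.1)]] with [V] a
    neighbourhood of [0]. The library's [equicontinuous] is avoided: the
    entourages of a [tvsType] induce its topology but are not required to be
    invariant under translation. *)
Definition tvs_equicontinuous (F : set (X -> X)) : Prop :=
  forall (x : X) (V : set X), nbhs 0 V ->
    \forall y \near x, forall f, F f -> V (f y - f x).

Definition power_bounded (T : X -> X) : Prop :=
  tvs_equicontinuous [set iter n T | n in [set n | (0 < n)%N]].

(** The filter of neighbourhoods of [S] for the topology of uniform convergence
    on bounded sets. *)
Definition nbhs_b (S : X -> X) : set_system (X -> X) :=
  filter_from [set BV : set X * set X | tvs_bounded BV.1 /\ nbhs 0 BV.2]
    (fun BV => [set Q | forall x, BV.1 x -> BV.2 (Q x - S x)]).

Definition cesaro_mean (T : X -> X) (n : nat) (x : X) : X :=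
  n%:R^-1 *: \sum_(1 <= m < n.+1) iter m T x.

Definition uniformly_mean_ergodic (T : X -> X) : Prop :=
  exists2 P : {linear X -> X}, continuous P
    & cesaro_mean T @ \oo --> nbhs_b P.

End LocallyConvexSpaces.

Arguments locally_complete {R} X.
Arguments ultrabornological {R} X.
Arguments webbed {R} X.

(* Main.v *)
From HB Require Import structures.
Require Import Defs.
From mathcomp Require Import cyclic separable cyclotomic ring lra.
Local Open Scope classical_set_scope.
Local Open Scope ring_scope.
Local Open Scope complex_scope.
Set Implicit Arguments.
Unset Strict Implicit.
Unset Printing Implicit Defensive.

(** Let [p] be the gauge of an absolutely convex neighbourhood of [0] that [T]
    maps into a compact set. Then [T] is bounded from [p] to every continuous
    seminorm, it is a compact map of the seminormed space [(X, p)], and it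
    vanishes on the null space of [p]. So it is enough to run Riesz theory in
    [(X, p)], where the missing completeness is supplied by compactness: the
    range [Y] of [1 - T] is closed, and for [|mu| <= 1] the map [1 - mu T] is
    bounded below on [Y], uniformly in [mu], and maps [Y] onto [Y]. For
    [mu != 0, 1] this is because [1 / mu] is not in the spectrum, and [mu = 1]
    is reached as a limit of [mu < 1]. Hence [X] is the direct sum of the kernel
    of [1 - T] and [Y].

    An elementary form of the spectral radius formula (averaging resolvents over
    roots of unity) then bounds the powers of [T] on [Y]. If [P] is the
    projection onto the kernel along [Y], then [x - P x = w - T w] with [w] in
    [Y], so the sum of [T^m x - P x] over [1 <= m <= n] telescopes to
    [T (w - T^n w)], which stays bounded. *)

Import ComplexField.Normc.

(** * Complex moduli and roots of unity *)

Section Preliminaries.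
Context {R : realType}.

Lemma normc_ge0 (a : R[i]) : 0 <= normc a.
Proof. by case: a => a b; exact: sqrtr_ge0. Qed.

Lemma normcR (t : R) : normc t%:C = `|t|.
Proof. by rewrite /= expr0n/= addr0 sqrtr_sqr. Qed.

Lemma normr_Re_le (z : R[i]) : `|complex.Re z| <= normc z.
Proof. by case: z => a b; rewrite -sqrtr_sqr ler_wsqrtr// lerDl sqr_ge0. Qed.

Lemma normr_Im_le (z : R[i]) : `|complex.Im z| <= normc z.
Proof. by case: z => a b; rewrite -sqrtr_sqr ler_wsqrtr// lerDr sqr_ge0. Qed.

Lemma normc_le (z : R[i]) : normc z <= `|complex.Re z| + `|complex.Im z|.
Proof.
case: z => a b /=; rewrite -[leRHS]ger0_norm ?addr_ge0// -sqrtr_sqr.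
rewrite ler_wsqrtr// sqrrD !real_normK ?num_real//.
by rewrite addrAC lerDl mulrn_wge0// mulr_ge0.
Qed.

Lemma normc_nat (n : nat) : normc n%:R = n%:R :> R.
Proof. by rewrite -(rmorph_nat (real_complex R)) normcR normr_nat. Qed.

Lemma normc_gt0 (a : R[i]) : a != 0 -> 0 < normc a.
Proof.
move=> a0; rewrite lt_neqAle normc_ge0 andbT eq_sym.
by apply: contraNneq a0 => /eq0_normc ->.
Qed.

Lemma realc_neq0 (t : R) : 0 < t -> t%:C != 0.
Proof.
by move=> t0; rewrite -(rmorph0 (real_complex R)) (inj_eq (@complexI _)) gt_eqF.
Qed.

Lemma normcX (a : R[i]) n : normc (a ^+ n) = normc a ^+ n.
Proof.
elim: n => [|n IHn]; first by rewrite !expr0 normc1.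
by rewrite !exprS normcM IHn.
Qed.

Lemma normc_unity_root (w : R[i]) n : (0 < n)%N -> w ^+ n = 1 -> normc w = 1.
Proof.
move=> n0 wn; apply/eqP; rewrite -(pexpr_eq1 n0) ?normc_ge0//.
by rewrite -normcX wn normc1.
Qed.

(** The polynomial ['X^n - 1] splits and is separable in characteristic 0, so it has [n] distinct
    roots, and [n] distinct [n]-th roots of unity include a primitive one. *)
Lemma prim_root_exists (n : nat) : (0 < n)%N ->
  exists w : R[i], n.-primitive_root w.
Proof.
move=> n0; pose P : {poly R[i]} := 'X^n - 1.
have [r Dp] := closed_field_poly_normal P.
have szP : size P = n.+1.
  by rewrite size_polyDl ?size_polyN ?size_poly1 size_polyXn ?ltnS.
have Pmon : lead_coef P = 1.
  by rewrite lead_coefDl ?lead_coefXn// size_polyN size_poly1 size_polyXn.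
rewrite Pmon scale1r in Dp.
have rn1 : all n.-unity_root r.
  by apply/allP => z; rewrite -root_prod_XsubC -Dp.
have szr : (n <= size r)%N by rewrite -ltnS -szP Dp size_prod_XsubC.
have [|w] := hasP (has_prim_root n0 rn1 _ szr); last by exists w.
rewrite -separable_prod_XsubC -Dp; apply: separable_Xn_sub_1.
by rewrite pnatr_eq0 -lt0n.
Qed.

(** Only [j = 0] survives: for [0 < j < n] the root of unity [w ^+ j] differs from 1, so its
    geometric sum vanishes. *)
Lemma prim_root_average (X : lmodType R[i]) (rho w : R[i]) n (v : nat -> X) :
    n.-primitive_root w ->
  \sum_(k < n) \sum_(j < n) (rho * w ^+ k) ^+ j *: v j = n%:R *: v 0%N.
Proof.
case: n => [|n] wn; first by rewrite big_ord0 scale0r.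
rewrite exchange_big/= (bigD1 ord0)//= [X in _ + X]big1 ?addr0.
  under eq_bigr do rewrite expr0 scale1r.
  by rewrite sumr_const card_ord -scaler_nat.
move=> j j0; rewrite -scaler_suml.
under eq_bigr do rewrite exprMn -exprM mulnC exprM.
rewrite -mulr_sumr.
have wj1 : w ^+ j != 1.
  by rewrite -(expr0 w) (eq_prim_root_expr wn) !modn_small.
have : (w ^+ j - 1) * \sum_(i < n.+1) (w ^+ j) ^+ i = 0.
  by rewrite -subrX1 -exprM mulnC exprM (prim_expr_order wn) expr1n subrr.
move/eqP; rewrite mulf_eq0 subr_eq0 (negPf wj1)/= => /eqP ->.
by rewrite mulr0 scale0r.
Qed.

Lemma eq0_small (a K : R) : 0 <= a -> (forall e, 0 < e -> a <= K * e) -> a = 0.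
Proof.
move=> a0 aK; apply/eqP; rewrite eq_le a0 andbT leNgt; apply/negP => {}a0.
have K0 : 0 < `|K| + 1 by rewrite ltr_pwDr.
have := aK (a / 2 / (`|K| + 1)) ltac:(by rewrite !divr_gt0).
rewrite leNgt => /negP; apply.
rewrite mulrA ltr_pdivrMr//; have := ler_norm K; have := normr_ge0 K; nra.
Qed.

Lemma invSn_small (e : R) : 0 < e ->
  exists N : nat, forall n, (N <= n)%N -> n.+1%:R^-1 < e.
Proof.
move=> e0; have [N _ NP] := near_infty_natSinv_lt (PosNum e0).
by exists N => n /NP.
Qed.

End Preliminaries.

(** * Seminormed spaces *)

Section SeminormedSpace.
Context {R : realType} {X : lmodType R[i]}.

Definition seminorm (p : X -> R) : Prop :=
  (forall x y, p (x + y) <= p x + p y) /\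
  (forall a x, p (a *: x) = normc a * p x).

Context (p : X -> R) (seminorm_p : seminorm p).

Lemma seminormD x y : p (x + y) <= p x + p y.
Proof. by case: seminorm_p. Qed.

Lemma seminormZ a x : p (a *: x) = normc a * p x.
Proof. by case: seminorm_p. Qed.

Lemma seminorm0 : p 0 = 0.
Proof. by rewrite -(scale0r 0) seminormZ normc0 mul0r. Qed.

Lemma seminormN x : p (- x) = p x.
Proof. by rewrite -scaleN1r seminormZ normcN normc1 mul1r. Qed.

Lemma seminorm_ge0 x : 0 <= p x.
Proof.
by have := seminormD x (- x); rewrite subrr seminorm0 seminormN; lra.
Qed.

Lemma seminorm_distC x y : p (x - y) = p (y - x).
Proof. by rewrite -seminormN opprB. Qed.

Lemma seminorm_triangle y x z : p (x - z) <= p (x - y) + p (y - z).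
Proof. by rewrite -[x - z](subrKA y); exact: seminormD. Qed.

Lemma seminormB x y : p (x - y) <= p x + p y.
Proof. by rewrite -(seminormN y); exact: seminormD. Qed.

Lemma seminorm_sum n (F : 'I_n -> X) : p (\sum_i F i) <= \sum_i p (F i).
Proof.
apply: (big_ind2 (fun x a => p x <= a)) => // [|x a y b xa yb].
  by rewrite seminorm0.
by rewrite (le_trans (seminormD x y))// lerD.
Qed.

Lemma seminorm_average n (F : 'I_n -> X) (M : R) : (0 < n)%N ->
  (forall i, p (F i) <= M) -> p (n%:R^-1 *: \sum_i F i) <= M.
Proof.
move=> n0 FM; rewrite seminormZ normcV normc_nat.
rewrite ler_pdivrMl ?ltr0n//.
have -> : n%:R * M = \sum_(i < n) M by rewrite sumr_const card_ord mulr_natl.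
by apply: le_trans (ler_sum _ (fun i _ => FM i)); exact: seminorm_sum.
Qed.

End SeminormedSpace.

Lemma iter_is_linear (R : realType) (X : lmodType R[i])
    (T : {linear X -> X}) n :
  linear (iter n T).
Proof. by move=> a x y; elim: n => //= n ->; rewrite linearP. Qed.

HB.instance Definition _ (R : realType) (X : lmodType R[i])
    (T : {linear X -> X}) n :=
  GRing.isLinear.Build R[i] X X _ (iter n T) (@iter_is_linear R X T n).

Lemma iter_telescope (R : realType) (X : lmodType R[i]) (T : {linear X -> X})
    (a : R[i]) n x :
  \sum_(j < n) a ^+ j *: iter j T (x - a *: T x) = x - a ^+ n *: iter n T x.
Proof.
elim: n => [|n IHn]; first by rewrite big_ord0 expr0 scale1r subrr.
rewrite big_ord_recr/= IHn [iter n T (_ - _)]linearB/=.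
rewrite [iter n T (_ *: _)]linearZ/=.
by rewrite scalerBr scalerA -exprSr -iterSr subrKA.
Qed.

(** Companion of [iter_telescope] with [1 - a T] on the other side of the geometric sum; the two
    agree because [T] commutes with its powers. *)
Lemma iter_geometric (R : realType) (X : lmodType R[i]) (T : {linear X -> X})
    (a : R[i]) n x (s := \sum_(j < n) a ^+ j *: iter j T x) :
  s - a *: T s = x - a ^+ n *: iter n T x.
Proof.
rewrite -iter_telescope /s linear_sum scaler_sumr -sumrB.
apply: eq_bigr => j _; rewrite [T (_ *: _)]linearZ/= scalerA mulrC -scalerA.
rewrite -scalerBr [iter j T (_ - _)]linearB/= [iter j T (_ *: _)]linearZ/=.
by rewrite -iterS iterSr.
Qed.

(** * Riesz theory of a compact map on a seminormed space *)

Section RieszTheory.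
Context {R : realType} {X : lmodType R[i]}.
Context (p : X -> R) (seminorm_p : seminorm p) (T : {linear X -> X}).
Context (c0 : R) (c0_ge0 : 0 <= c0) (pT : forall x, p (T x) <= c0 * p x).
Context (Tker : forall x, p x = 0 -> T x = 0).
(** The scalars [m n] are part of the compactness hypothesis because
    [approximate_solution] needs them to converge along with [T (x n)]. *)
Context (Tcpt : forall (m : nat -> R[i]) (x : nat -> X),
  (forall n, normc (m n) <= 1) -> (forall n, p (x n) <= 1) ->
  exists mu w, normc mu <= 1 /\ forall (e : R) N, 0 < e ->
    exists n, [/\ (N <= n)%N, normc (m n - mu) < e & p (T (x n) - w) < e]).

Let p_ge0 := seminorm_ge0 seminorm_p.
Let pD := seminormD seminorm_p.
Let pZ := seminormZ seminorm_p.
Let p_triangle := seminorm_triangle seminorm_p.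

(** A cluster point of [T (x n)] gives a solution up to a vector of seminorm
    [0], and [T] kills such vectors. *)
Lemma approximate_solution (m : nat -> R[i]) (x : nat -> X) (y : X) (M : R) :
    (forall n, normc (m n) <= 1) -> (forall n, p (x n) <= M) ->
    (forall n, p (x n - m n *: T (x n) - y) <= n.+1%:R^-1) ->
  exists mu z, [/\ normc mu <= 1, z - mu *: T z = y &
    forall (e : R) N, 0 < e ->
      exists n, [/\ (N <= n)%N, normc (m n - mu) < e & p (x n - z) < e]].
Proof.
move=> m1 xM xy.
wlog M0 : M xM / 0 < M.
  move/(_ (M + 1)); apply=> [n|]; first by have := xM n; lra.
  by have := xM 0%N; have := p_ge0 (x 0%N); lra.
have [|mu [w [mu1 mw]]] := Tcpt (x := fun n => M^-1%:C *: x n) m1.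
  by move=> n; rewrite pZ normcR gtr0_norm ?invr_gt0// ler_pdivrMl ?mulr1.
have [v vE] : exists v, v = M%:C *: w by exists (M%:C *: w).
(* Up to a small error [x n] is [y + m n *: T (x n)], and [T (x n)] clusters at [v] along with [m n]
   at [mu]; so [x n] must cluster at this [u]. *)
have [u uE] : exists u, u = y + mu *: v by exists (y + mu *: v).
have Tv n : p (T (x n) - v) = M * p (T (M^-1%:C *: x n) - w).
  have {1}-> : M = normc M%:C by rewrite normcR gtr0_norm.
  rewrite -pZ [T (_ *: _)]linearZ/= scalerBr scalerA vE.
  by rewrite -rmorphM/= divff ?gt_eqF// scale1r.
have xu n : p (x n - u) <=
    n.+1%:R^-1 + normc (m n - mu) * (c0 * M) + p (T (x n) - v).
  have -> : x n - u = (x n - m n *: T (x n) - y) + ((m n - mu) *: T (x n) +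
      mu *: (T (x n) - v)).
    rewrite uE scalerBl scalerBr subrKA [x n - _ - y]addrAC subrKA.
    by rewrite opprD addrA.
  apply: le_trans (pD _ _) _; rewrite -[leRHS]addrA lerD//.
  apply: le_trans (pD _ _) _; rewrite !pZ lerD//.
    rewrite ler_wpM2l ?normc_ge0//; apply: le_trans (pT _) _.
    by rewrite ler_wpM2l.
  by rewrite ler_piMl.
have freq (e : R) N : 0 < e -> exists n,
    [/\ (N <= n)%N, normc (m n - mu) < e, p (T (x n) - v) < e
      & p (x n - u) < e].
  move=> e0; pose K := 3 * (1 + c0 * M + M).
  have cM : 0 <= c0 * M by rewrite mulr_ge0// ltW.
  have K0 : 0 < K by rewrite /K; lra.
  have eK0 : 0 < e / K by rewrite divr_gt0.
  have [N' NP] := invSn_small eK0.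
  have [n [Nn nmu nw]] := mw (e / K) (maxn N N') eK0.
  move: Nn; rewrite geq_max => /andP[Nn /NP n1].
  have eE : e = 3 * (e / K) + 3 * (c0 * M * (e / K)) + 3 * (M * (e / K)).
    by rewrite -[LHS](divfK (lt0r_neq0 K0)) {2}/K; ring.
  move: (e / K) eK0 n1 nmu nw eE => q q0 n1 nmu nw eE.
  have h1 : p (T (x n) - v) <= M * q by rewrite Tv ler_pM2l// ltW.
  have h2 : normc (m n - mu) * (c0 * M) <= c0 * M * q.
    by rewrite mulrC ler_wpM2l// ltW.
  have h3 : 0 < M * q by rewrite mulr_gt0.
  have h4 : 0 <= c0 * M * q by rewrite mulr_ge0// ltW.
  have xun : p (x n - u) <= q + c0 * M * q + M * q.
    by apply: le_trans (xu n) _; rewrite !lerD// ltW.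
  exists n; split=> //; first lra.
    by apply: le_lt_trans h1 _; lra.
  by apply: le_lt_trans xun _; lra.
have pu : p (u - mu *: T u - y) = 0.
  apply: (@eq0_small _ _ (1 + c0)) => // e e0.
  have [n [_ _ nv nu]] := freq e 0%N e0.
  have -> : u - mu *: T u - y = mu *: ((v - T (x n)) + T (x n - u)).
    rewrite [T (_ - _)]linearB/= subrKA scalerBr {1}uE (addrC y).
    by rewrite [X in X - y]addrAC addrK.
  rewrite pZ; apply: le_trans (_ : p ((v - T (x n)) + T (x n - u)) <= _).
    by rewrite ler_piMl.
  apply: le_trans (pD _ _) _; rewrite mulrDl mul1r lerD//.
    by rewrite seminorm_distC// ltW.
  by apply: le_trans (pT _) _; rewrite ler_wpM2l// ltW.
(* The defect of [u] has seminorm 0, so [T] kills it, and subtracting it once makes the equation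
   exact. *)
exists mu, (u - (u - mu *: T u - y)); split=> //.
  by rewrite [T (_ - _)]linearB/= (Tker pu) subr0 addrAC subKr.
move=> e N e0; have [n [Nn nmu _ nu]] := freq e N e0; exists n; split=> //.
apply: le_lt_trans (p_triangle u _ _) _.
by rewrite [X in _ + p X]subKr pu addr0.
Qed.


Lemma approximate_fixpoint (x : nat -> X) (y : X) (M : R) :
    (forall n, p (x n) <= M) ->
    (forall n, p (x n - T (x n) - y) <= n.+1%:R^-1) ->
  exists2 z, z - T z = y &
    forall (e : R) N, 0 < e -> exists2 n, (N <= n)%N & p (x n - z) < e.
Proof.
move=> xM xy.
have [||mu [z [_ zy xz]]] := @approximate_solution (fun=> 1) x y M _ xM.
- by move=> n; rewrite normc1.
- by move=> n; rewrite scale1r.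
suff mu1 : mu = 1.
  rewrite mu1 scale1r in zy; exists z => // e N e0.
  by have [n [Nn _ nz]] := xz e N e0; exists n.
apply/esym/subr0_eq/eq0_normc/(@eq0_small _ _ 1) => [|e e0].
  exact: normc_ge0.
by have [n [_ /ltW ne _]] := xz e 0%N e0; rewrite mul1r.
Qed.

(** Otherwise there are vectors [w n] of seminorm at most 1, almost at distance 1 from the kernel of
    [1 - T], with [w n - T (w n)] tending to 0. They cluster at a point of that kernel, which is
    absurd. *)
Lemma distance_to_kernel : exists2 c : R, 0 <= c &
  forall z, exists2 k, T k = k & p (z - k) <= c * p (z - T z).
Proof.
apply: contrapT => noc.
have H n : exists w, [/\ p w <= 1, p (w - T w) <= n.+1%:R^-1 &
    forall k, T k = k -> 1 - n.+1%:R^-1 <= p (w - k)].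
  apply: contrapT => now; apply: noc; exists n.+1%:R => // z.
  (* If the seminorm is 0, then [T] kills [z - T z], so [T z] is itself a fixed point. *)
  have [s0|s0] := eqVneq (p (z - T z)) 0.
    exists (T z); last by rewrite s0 mulr0.
    by apply/subr0_eq; rewrite -linearB -opprB linearN/= (Tker s0) oppr0.
  have {}s0 : 0 < p (z - T z) by rewrite lt_neqAle eq_sym s0 p_ge0.
  apply: contrapT => nok; apply: now.
  have {}nok k : T k = k -> n.+1%:R * p (z - T z) < p (z - k).
    by move=> kT; rewrite ltNge; apply/negP => ?; apply: nok; exists k.
  pose E := [set p (z - k) | k in [set k | T k = k]].
  have E0 : has_lbound E by exists 0 => _ [k _ <-].
  have EI : has_inf E.
    by split=> //; exists (p (z - 0)), 0 => //=; rewrite linear0.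
  (* [k0] is a nearest kernel point up to [p (z - T z)]. Relative to [q] this error is below
     [1 / (n + 1)], so the normalised [z - k0] is almost at distance 1. *)
  have [_ [k0 /= k0T <-] k0E] := inf_adherent s0 EI.
  have q0 : 0 < p (z - k0).
    by apply: le_lt_trans (nok _ k0T); rewrite mulr_ge0.
  have qE k : T k = k -> p (z - k0) < p (z - k) + p (z - T z).
    by move=> kT; apply: lt_le_trans k0E _; rewrite lerD2r ge_inf//; exists k.
  set q := p (z - k0) in q0 qE k0E.
  have sq : q^-1 * p (z - T z) <= n.+1%:R^-1.
    by rewrite ler_pdivrMl// ler_pdivlMr// mulrC ltW// nok.
  have pq x : p (q^-1%:C *: x) = q^-1 * p x.
    by rewrite pZ normcR gtr0_norm ?invr_gt0.
  exists (q^-1%:C *: (z - k0)); split.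
  - by rewrite pq mulVf// gt_eqF.
  - rewrite [T (_ *: _)]linearZ/= -scalerBr pq [T (_ - _)]linearB/= k0T.
    by rewrite opprB addrA subrK.
  move=> k kT; have -> : q^-1%:C *: (z - k0) - k =
      q^-1%:C *: (z - (k0 + q%:C *: k)).
    rewrite opprD addrA [RHS]scalerBr scalerA -rmorphM/= mulVf ?gt_eqF//.
    by rewrite scale1r.
  rewrite pq; apply: le_trans (_ : 1 - q^-1 * p (z - T z) <= _).
    by rewrite lerD2l lerN2.
  rewrite lerBlDr -mulrDr ler_pdivlMl// mulr1 ltW// qE//.
  by rewrite linearD linearZ/= k0T kT.
have [w wP] := choice H.
have [|n|z /eqP zT wz] := @approximate_fixpoint w 0 1.
- by move=> n; have [] := wP n.
- by rewrite subr0; have [] := wP n.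
(* From index 3 on, the distance to the kernel is at least [1 - 1/4], against [1/4] here. *)
have [n n3 nz] := wz 4^-1 3%N ltac:(by rewrite invr_gt0).
have [_ _ /(_ z)] := wP n; rewrite subr_eq0 in zT; move/(_ (esym (eqP zT))).
have n4 : n.+1%:R^-1 <= 4^-1 :> R by rewrite lef_pV2 ?posrE// ler_nat.
by move: nz n4; set a := p _; set b := n.+1%:R^-1; lra.
Qed.

Local Notation Y := (range (fun x => x - T x)).

(** Preimages of approximants of [u] can be corrected by kernel elements so that they stay bounded,
    by [distance_to_kernel]; a cluster point is then a preimage of [u]. *)
Lemma range_closed u :
  (forall e : R, 0 < e -> exists2 y, Y y & p (y - u) <= e) -> Y u.
Proof.
move=> uY; have [c c_ge0 cP] := distance_to_kernel.
have H n : exists z, p (z - T z - u) <= n.+1%:R^-1 /\ p z <= c * (p u + 1).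
  have [|_ [z _ <-] zu] := uY n.+1%:R^-1; first by rewrite invr_gt0.
  have [k kT zk] := cP z; exists (z - k).
  have -> : z - k - T (z - k) = z - T z.
    by rewrite [T (_ - _)]linearB/= kT opprB addrA subrK.
  split=> //; apply: le_trans zk _; rewrite ler_wpM2l//.
  rewrite -[z - T z](subrK u) (le_trans (pD _ _))// addrC lerD2l.
  by apply: le_trans zu _; rewrite invf_le1// ler1n.
have [z zP] := choice H.
have [|n|v vu _] := @approximate_fixpoint z u (c * (p u + 1)).
- by move=> n; have [] := zP n.
- by have [] := zP n.
by exists v.
Qed.

(** * Invertibility of [1 - mu T] on the range of [1 - T] *)

Context (range_kernel : forall x, T x = x -> Y x -> x = 0).
Context (injective_mu : forall mu x,
  normc mu <= 1 -> mu != 1 -> x - mu *: T x = 0 -> x = 0).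
Context (surjective_mu : forall mu y,
  normc mu <= 1 -> mu != 1 -> exists x, x - mu *: T x = y).

(** Uniformity in [mu] comes from letting the scalars vary too: normalised counterexamples cluster
    at a pair [(mu, z)] with [z] in the closed range and [z = mu *: T z]. Injectivity, or
    [range_kernel] if [mu = 1], forces [z = 0], against seminorm 1. *)
Lemma range_lower_bound : exists2 c : R, 0 < c &
  forall mu y, normc mu <= 1 -> Y y -> p y <= c * p (y - mu *: T y).
Proof.
apply: contrapT => noc.
have H n : exists muy : R[i] * X, [/\ normc muy.1 <= 1, Y muy.2, p muy.2 = 1 &
    p (muy.2 - muy.1 *: T muy.2) <= n.+1%:R^-1].
  apply: contrapT => now; apply: noc; exists n.+1%:R => // mu y mu1 Yy.
  rewrite leNgt; apply/negP => h; apply: now.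
  have q0 : 0 < p y by apply: le_lt_trans h; rewrite mulr_ge0.
  have pq x : p ((p y)^-1%:C *: x) = (p y)^-1 * p x.
    by rewrite pZ normcR gtr0_norm ?invr_gt0.
  exists (mu, (p y)^-1%:C *: y); split=> //=.
  - case: Yy => x _ <-; exists ((p (x - T x))^-1%:C *: x) => //.
    by rewrite linearZ/= -scalerBr.
  - by rewrite pq mulVf// gt_eqF.
  rewrite /= [T (_ *: _)]linearZ/= [mu *: _]scalerA [mu * _]mulrC -scalerA.
  rewrite -scalerBr pq.
  by rewrite ler_pdivrMl// ler_pdivlMr// mulrC ltW.
have [my myP] := choice H.
have [||n|mu [z [mu1 zmu yz]]] :=
    @approximate_solution (fst \o my) (snd \o my) 0 1.
- by move=> n; have [] := myP n.
- by move=> n /=; have [_ _ ->] := myP n.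
- by rewrite subr0; have [] := myP n.
have Yz : Y z.
  apply: range_closed => e e0; have [n [_ _ nz]] := yz e 0%N e0.
  by exists (my n).2; [have [] := myP n|exact: ltW].
have z0 : z = 0.
  have [mu1E|mu1E] := eqVneq mu 1; last exact: injective_mu zmu.
  by apply: range_kernel => //; apply/esym/subr0_eq; rewrite -zmu mu1E scale1r.
have [n [_ _]] := yz 1 0%N ltr01.
by rewrite /= z0 subr0; have [_ _ -> _] := myP n; rewrite ltxx.
Qed.

Lemma range_onto mu y : normc mu <= 1 -> Y y ->
  exists2 g, Y g & g - mu *: T g = y.
Proof.
(* Solve for a preimage of [y] under [1 - T], then apply [1 - T], which commutes with [1 - nu T]. *)
have onto nu : normc nu <= 1 -> nu != 1 -> Y y ->
    exists2 g, Y g & g - nu *: T g = y.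
  move=> nu1 nu1E [w _ <-]; have [h hw] := surjective_mu w nu1 nu1E.
  exists (h - T h); first by exists h.
  rewrite -hw [T (h - T h)]linearB/= [T (h - _)]linearB/= [T (_ *: _)]linearZ/=.
  by rewrite scalerBr !opprD addrACA.
have [->|mu1E] := eqVneq mu 1; last by move=> mu1; exact: onto.
move=> _ Yy; have [c c0' cP] := range_lower_bound.
(* Scalars in the unit disc, different from 1 and tending to 1. The uniform lower bound keeps the
   corresponding solutions bounded. *)
pose m (n : nat) : R[i] := (1 - n.+1%:R^-1)%:C.
have m1 n : normc (m n) <= 1.
  have n1 : n.+1%:R^-1 <= 1 :> R by rewrite invf_le1// ler1n.
  by rewrite normcR ger0_norm ?subr_ge0// gerBl.
have H n : exists g, Y g /\ g - m n *: T g = y.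
  suff mn1 : m n != 1 by have [g Yg gy] := onto _ (m1 n) mn1 Yy; exists g.
  rewrite /m -(rmorph1 (real_complex R)) (inj_eq (@complexI _)).
  by rewrite -subr_eq0 addrAC subrr add0r oppr_eq0 invr_eq0.
have [g gP] := choice H.
have [n|n|n|mu' [z [_ zy gz]]] := @approximate_solution m g y (c * p y).
- exact: m1.
- by have [Yg <-] := gP n; exact: cP.
- by have [_ ->] := gP n; rewrite subrr seminorm0// invr_ge0.
have Yz : Y z.
  apply: range_closed => e e0; have [n [_ _ nz]] := gz e 0%N e0.
  by exists (g n); [have [] := gP n|exact: ltW].
exists z => //; rewrite -zy; congr (_ - _ *: _).
apply/subr0_eq/eq0_normc/(@eq0_small _ _ 2) => [|e e0].
  exact: normc_ge0.
have [N NP] := invSn_small e0.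
have [n [/NP Nn nmu _]] := gz e N e0.
rewrite -(subrKA (m n)); apply: le_trans (le_normcD _ _) _.
suff -> : normc (1 - m n) = n.+1%:R^-1.
  by rewrite mulr_natl mulr2n lerD// ltW.
have -> : 1 - m n = (n.+1%:R^-1)%:C by rewrite /m rmorphB rmorph1 subKr.
by rewrite normcR ger0_norm// invr_ge0.
Qed.


(** * Power bounds on the range of [1 - T] *)

Lemma rangeD x y : Y x -> Y y -> Y (x + y).
Proof.
move=> [v _ <-] [w _ <-]; exists (v + w) => //.
by rewrite linearD opprD addrACA.
Qed.

Lemma rangeZ a x : Y x -> Y (a *: x).
Proof.
by move=> [v _ <-]; exists (a *: v) => //; rewrite linearZ/= scalerBr.
Qed.

Lemma rangeB x y : Y x -> Y y -> Y (x - y).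
Proof.
by move=> Yx Yy; rewrite -scaleN1r; apply: rangeD => //; exact: rangeZ.
Qed.

Lemma range_sum n (F : 'I_n -> X) : (forall i, Y (F i)) -> Y (\sum_i F i).
Proof.
move=> YF; elim/big_ind : _ => //; last by move=> x y; exact: rangeD.
by exists 0 => //; rewrite linear0 subr0.
Qed.

Lemma range_iter n x : Y x -> Y (iter n T x).
Proof.
move=> [v _ <-]; exists (iter n T v) => //.
by rewrite [iter n T (_ - _)]linearB/= -iterS iterSr.
Qed.

(** If [(rho T)^n] is small on [Y], then averaging the resolvents
    [(1 - rho w^k T)^-1] over the [n]-th roots of unity [w^k] gives an operator
    [(1 - (rho T)^n)^-1] close to [1]. The resolvents are uniformly Lipschitz in
    [rho], so the average stays close to [1] for [rho'] near [rho]. *)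
Lemma power_step (c rho rho' : R) n :
    0 < c ->
    (forall mu y, normc mu <= 1 -> Y y -> p y <= c * p (y - mu *: T y)) ->
    0 <= rho <= rho' -> rho' <= 1 -> (0 < n)%N ->
    c * ((rho' - rho) * (c0 * c)) <= 8^-1 ->
    (forall y, Y y -> rho ^+ n * p (iter n T y) <= 8^-1 * p y) ->
  forall y, Y y -> rho' ^+ n * p (iter n T y) <= 2^-1 * p y.
Proof.
move=> c_gt0 cP /andP[rho0 rhorho'] rho'1 n0 csmall hrho x Yx.
have rho'0 := le_trans rho0 rhorho'.
have [w wn] := prim_root_exists (R := R) n0.
have nw k : normc (w ^+ k) = 1.
  by apply: (normc_unity_root n0); rewrite exprAC (prim_expr_order wn) expr1n.
have norma r k : 0 <= r -> normc (r%:C * w ^+ k) = r.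
  by move=> r0; rewrite normcM nw mulr1 normcR ger0_norm.
have an (r : R) k : (r%:C * w ^+ k) ^+ n = (r ^+ n)%:C.
  by rewrite exprMn exprAC (prim_expr_order wn) expr1n mulr1 rmorphXn.
pose y := x - (rho' ^+ n)%:C *: iter n T x.
have Yy : Y y by apply: rangeB => //; apply/rangeZ/range_iter.
(* With this [y], the resolvent at [rho'] is an explicit geometric sum, and the average of the
   [g' k] is [x]. *)
pose g' k := \sum_(j < n) (rho'%:C * w ^+ k) ^+ j *: iter j T x.
have Yg' k : Y (g' k) by apply: range_sum => j; apply/rangeZ/range_iter.
have g'y k : g' k - (rho'%:C * w ^+ k) *: T (g' k) = y.
  by rewrite iter_geometric an.
have H k : exists v, Y v /\ v - (rho%:C * w ^+ k) *: T v = y.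
  have [||v Yv vy] := @range_onto (rho%:C * w ^+ k) y; last by exists v.
    by rewrite norma// (le_trans rhorho').
  by [].
have [g gP] := choice H.
have Yg k : Y (g k) by have [] := gP k.
have gy k : g k - (rho%:C * w ^+ k) *: T (g k) = y by have [] := gP k.
(* The resolvent identity, with one lower bound for the difference and one for [g k]; this gives the
   two factors [c] in the smallness hypothesis. *)
have gg' k : p (g k - g' k) <= 8^-1 * p y.
  apply: le_trans (cP (rho'%:C * w ^+ k) _ _ (rangeB (Yg k) (Yg' k))) _.
    by rewrite norma.
  have -> : g k - g' k - (rho'%:C * w ^+ k) *: T (g k - g' k) =
      (rho%:C * w ^+ k - rho'%:C * w ^+ k) *: T (g k).
    rewrite [T (_ - _)]linearB/= scalerBr scalerBl opprB.
    have -> : g k - g' k =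
        (rho%:C * w ^+ k) *: T (g k) - (rho'%:C * w ^+ k) *: T (g' k).
      rewrite -{1}(subrK ((rho%:C * w ^+ k) *: T (g k)) (g k)) gy -{1}(g'y k).
      by rewrite -[X in X - g' k]addrA [g' k + _]addrC addrK addrC.
    by rewrite subrKA.
  have -> : rho%:C * w ^+ k - rho'%:C * w ^+ k = (rho - rho')%:C * w ^+ k.
    by rewrite -mulrBl -rmorphB.
  rewrite pZ normcM nw mulr1 normcR.
  rewrite distrC ger0_norm ?subr_ge0//.
  apply: le_trans (_ : c * ((rho' - rho) * (c0 * c)) * p y <= _); last first.
    by rewrite ler_wpM2r.
  rewrite -!mulrA ler_wpM2l ?(ltW c_gt0)// ler_wpM2l ?subr_ge0//.
  apply: le_trans (pT _) _; rewrite ler_wpM2l// -(gy k) cP// norma//.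
  exact: le_trans rho'1.
pose z := n%:R^-1 *: \sum_(k < n) g k.
have Yz : Y z by apply/rangeZ/range_sum.
have nC0 : n%:R != 0 :> R[i] by rewrite pnatr_eq0 -lt0n.
have zx : p (z - x) <= 8^-1 * p y.
  have -> : x = n%:R^-1 *: \sum_(k < n) g' k.
    by rewrite prim_root_average// scalerA mulVf// scale1r.
  by rewrite -scalerBr -sumrB seminorm_average.
(* Averaging the resolvents at [rho] inverts [1 - (rho T)^n], so [z - y] is [(rho T)^n z]. *)
have zy : p (z - y) <= 8^-1 * p z.
  have -> : y = z - (rho ^+ n)%:C *: iter n T z.
    have -> : y = n%:R^-1 *: \sum_(k < n) \sum_(j < n)
        (rho%:C * w ^+ k) ^+ j *: iter j T y.
      by rewrite prim_root_average// scalerA mulVf// scale1r.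
    rewrite /z [iter n T (_ *: _)]linearZ/= scalerA mulrC -scalerA -scalerBr.
    congr (_ *: _); rewrite [iter n T _]linear_sum scaler_sumr -sumrB.
    apply: eq_bigr => k _; rewrite -(an _ k) -iter_telescope.
    by apply: eq_bigr => j _; rewrite gy.
  by rewrite subKr pZ normcR ger0_norm ?exprn_ge0// hrho.
have xyE : p (x - y) = rho' ^+ n * p (iter n T x).
  by rewrite /y subKr pZ normcR ger0_norm ?exprn_ge0.
(* The bounds give [p z <= 8/7 p y], hence [p (x - y) <= 15/56 p y], and finally
   [p (x - y) <= 15/41 p x], which is below one half. *)
rewrite -xyE.
have h1 := p_triangle z x y; rewrite (seminorm_distC seminorm_p x z) in h1.
have h2 : p z <= p y + p (z - y).
  by have := pD y (z - y); rewrite (addrC y) subrK.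
have h3 : p y <= p x + p (x - y).
  by have := seminormB seminorm_p x (x - y); rewrite subKr.
have := p_ge0 x; lra.
Qed.

(** [rho] moves from 0 to 1 in equal steps. The admissible step length depends on [c] and [c0] but
    not on the exponent, so finitely many steps suffice although the exponent grows. *)
Lemma range_contraction : exists2 n, (0 < n)%N &
  forall y, Y y -> p (iter n T y) <= 8^-1 * p y.
Proof.
have [c c_gt0 cP] := range_lower_bound.
have [N NP] : exists N : nat, c * (N.+1%:R^-1 * (c0 * c)) <= 8^-1.
  pose K := c * (c0 * c).
  have K0 : 0 <= K by rewrite !mulr_ge0// ltW.
  have K1 : 0 < 8 * (K + 1) by lra.
  have [N NP] := @invSn_small _ (8 * (K + 1))^-1 ltac:(by rewrite invr_gt0).
  exists N; rewrite mulrCA -/K; apply: le_trans (_ : (8 * (K + 1))^-1 * K <= _).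
    by rewrite ler_wpM2r// ltW// NP.
  by rewrite mulrC ler_pdivrMr//; lra.
suff H i : (i <= N.+1)%N -> exists2 n, (0 < n)%N &
    forall y, Y y -> (i%:R / N.+1%:R) ^+ n * p (iter n T y) <= 8^-1 * p y.
  have [n n0 nP] := H _ (leqnn _); exists n => // y /nP.
  by rewrite divff ?pnatr_eq0// expr1n mul1r.
elim: i => [|i IHi] iN.
  by exists 1%N => // y Yy; rewrite mul0r expr1 mul0r mulr_ge0// invr_ge0.
have [n n0 nP] := IHi (ltnW iN).
have step := power_step c_gt0 cP _ _ n0 _ nP.
have {step} step (y : X) : Y y ->
    (i.+1%:R / N.+1%:R) ^+ n * p (iter n T y) <= 2^-1 * p y.
  apply: step; rewrite ?divr_ge0//=.
  - by rewrite ler_pM2r ?invr_gt0// ler_nat.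
  - by rewrite ler_pdivrMr// mul1r ler_nat.
  by rewrite -mulrBl -natrB// subSnn mul1r.
(* Tripling the exponent turns the factor [1/2] back into the [1/8] needed for the next step. *)
exists (n + (n + n))%N; first by rewrite addn_gt0 n0.
move=> y Yy; set r := i.+1%:R / N.+1%:R in step *.
have r0 : 0 <= r ^+ n by rewrite exprn_ge0// divr_ge0.
rewrite !iterD !exprD.
have h1 := step _ Yy; have h2 := step _ (range_iter n Yy).
have h3 := step _ (range_iter n (range_iter n Yy)).
move: (r ^+ n) (p y) (p (iter n T y)) (p (iter n T (iter n T y))) r0 h1 h2 h3.
move=> a p0 p1 p2 a0; set p3 := p _ => h1 h2 h3.
have h4 : a * (a * (a * p3)) <= a * (a * (2^-1 * p2)) by rewrite !ler_wpM2l.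
have h5 : a * (a * p2) <= a * (2^-1 * p1) by rewrite ler_wpM2l.
lra.
Qed.

(** Blocks of [m] iterations do not increase [p], and fewer than [m] iterations cost at most
    [(1 + c0) ^+ m]. *)
Lemma range_power_bounded : exists2 C : R, 0 <= C &
  forall n y, Y y -> p (iter n T y) <= C * p y.
Proof.
have [m m0 mP] := range_contraction.
have pTn n x : p (iter n T x) <= (1 + c0) ^+ n * p x.
  elim: n => [|n IHn]; first by rewrite expr0 mul1r.
  rewrite iterS exprS; apply: le_trans (pT _) _.
  by rewrite -mulrA ler_pM// lerDr.
exists ((1 + c0) ^+ m); first by rewrite exprn_ge0// addr_ge0.
move=> n y Yy.
elim/ltn_ind: n => n IHn; have [nm|mn] := ltnP n m.
  have c1 : (1 + c0) ^+ n <= (1 + c0) ^+ m.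
    by apply: ler_weXn2l; [rewrite lerDl|exact: ltnW].
  by apply: le_trans (pTn n y) _; exact: ler_wpM2r.
rewrite -(subnKC mn) iterD.
apply: le_trans (mP _ (range_iter _ Yy)) _.
have nm : (n - m < n)%N by rewrite ltn_subrL m0 (leq_trans m0).
apply: le_trans (IHn _ nm).
by rewrite ler_piMl// invf_le1 ?ler1n.
Qed.

(** [1 - T] is inverted on its range twice: [z] has the same image as [x], so [x - z] is fixed, and
    [w] in the range is a preimage of [z]. Each inversion costs a factor [c]. *)
Lemma riesz_decomposition : exists2 C : R, 0 <= C & forall x, exists w,
  T (x - (w - T w)) = x - (w - T w) /\ forall n, p (iter n T w) <= C * p x.
Proof.
have [c c_gt0 cP] := range_lower_bound.
have [C C0 CP] := range_power_bounded.
pose D := c * (c * (1 + c0)).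
have D0 : 0 <= D by rewrite !mulr_ge0 ?addr_ge0// ltW.
exists (C * D); first exact: mulr_ge0.
have norm1 : normc (1 : R[i]) <= 1 by rewrite normc1.
move=> x.
have [z Yz zx] := @range_onto 1 (x - T x) norm1 (ex_intro2 _ _ x I erefl).
have [w Yw wz] := @range_onto 1 z norm1 Yz.
rewrite scale1r in zx; rewrite scale1r in wz; exists w; rewrite wz; split.
  rewrite linearB/= -[x in RHS](subrK (T x)) -zx -[X in X - z]addrA.
  by rewrite [z + _]addrC addrK addrC.
move=> n; apply: le_trans (CP _ _ Yw) _; rewrite -mulrA ler_wpM2l//.
apply: le_trans (cP 1 _ norm1 Yw) _.
rewrite scale1r wz -mulrA ler_wpM2l ?(ltW c_gt0)//.
apply: le_trans (cP 1 _ norm1 Yz) _.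
rewrite scale1r zx -mulrA ler_wpM2l ?(ltW c_gt0)//.
by apply: le_trans (seminormB seminorm_p _ _) _; rewrite mulrDl mul1r lerD2l.
Qed.

Lemma riesz_projection : exists (P : {linear X -> X}) (C : R), 0 <= C /\
  forall x, T (P x) = P x /\ exists2 w, x - P x = w - T w &
    forall n, p (iter n T w) <= C * p x.
Proof.
have [C C0 H] := riesz_decomposition.
have [w wP] := choice H.
have [P PE] : exists P : X -> X, forall x, P x = x - (w x - T (w x)).
  by exists (fun x => x - (w x - T (w x))).
have wE x : w x - T (w x) = x - P x by rewrite PE subKr.
have TP x : T (P x) = P x by rewrite PE; have [] := wP x.
have Plin : linear P.
  (* [w] is merely chosen, but the linearity defect of [P] lies both in the kernel and in the range
     of [1 - T], so it is 0. *)
  move=> a x y; apply/subr0_eq/range_kernel.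
    rewrite [T (_ - _)]linearB/= [T (_ + _)]linearD/= [T (_ *: _)]linearZ/=.
    by rewrite !TP.
  have -> : P (a *: x + y) - (a *: P x + P y) =
      (a *: (w x - T (w x)) + (w y - T (w y))) -
      (w (a *: x + y) - T (w (a *: x + y))).
    by rewrite !wE scalerBr addrACA -opprD opprB [RHS]addrC subrKA.
  have Yw z : Y (w z - T (w z)) by exists (w z).
  by apply: rangeB => //; apply: rangeD => //; exact: rangeZ.
pose Pmix := GRing.isLinear.Build _ _ _ _ P Plin.
pose PL : {linear X -> X} := HB.pack P Pmix.
exists PL, C; split=> // x; split; first exact: TP.
by exists (w x); [rewrite wE|have [] := wP x].
Qed.

End RieszTheory.

(** * Continuous seminorms on locally convex spaces *)

Section ContinuousSeminorms.
Context {R : realType} {X : tvsType R[i]}.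

Definition gauge (W : set X) (x : X) : R :=
  inf [set t : R | 0 < t /\ W (t^-1%:C *: x)].

Lemma convex_setP (W : set X) (t : R) x y : convex_set W ->
  0 <= t <= 1 -> W x -> W y -> W (t%:C *: x + (1 - t)%:C *: y).
Proof.
move=> cW /andP[t0 t1] Wx Wy.
have t0C : 0 <= t%:C by rewrite ler0c.
have t1C : t%:C <= 1 by rewrite -(rmorph1 (real_complex R)) lecR.
have := cW x y (Itv01 t0C t1C) (mem_set Wx) (mem_set Wy).
by rewrite inE rmorphB rmorph1.
Qed.

(** Continuity of scaling at [(0, x)]: for general [x] it shows that neighbourhoods of 0 absorb
    points, and for [x = 0] it yields balanced neighbourhoods. *)
Lemma nbhs_scale0 (V : set X) (x : X) : nbhs 0 V ->
  exists (e : R) (B : set X), [/\ 0 < e, nbhs x B &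
    forall (t : R[i]) y, normc t < e -> B y -> V (t *: y)].
Proof.
move=> V0; have := @scale_continuous _ X (0, x) V; rewrite /= scale0r.
move=> /(_ V0)[[A B]/= [A0 Bx] AB].
have [e/= e0 eA] := (nbhs_ballP _ _).1 A0.
move: e0; rewrite ltcE/= => /andP[/eqP eI e0].
exists (complex.Re e), B; split=> // t y te By.
apply: (AB (t, y)); split => //=.
apply: eA; rewrite -ball_normE/= sub0r normrN.
by rewrite [e]complexE eI mulr0 addr0 ltcR.
Qed.

Lemma nbhs0_balanced (V : set X) : nbhs 0 V ->
  nbhs 0 [set x : X | forall a : R[i], normc a <= 1 -> V (a *: x)].
Proof.
move=> V0; have [e [B [e0 B0 eB]]] := nbhs_scale0 0 V0.
have e20 : (e / 2)%:C != 0 by rewrite realc_neq0// divr_gt0.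
apply: filterS (nbhs0Z e20 B0) => _ [x Bx <-] a a1.
rewrite scalerA; apply: eB => //.
rewrite normcM normcR gtr0_norm ?divr_gt0//.
by have := normc_ge0 a; nra.
Qed.

Section Gauge.
Context (W : set X) (W0 : nbhs 0 W) (convexW : convex_set W).
Context (balancedW : forall (a : R[i]) x, normc a <= 1 -> W x -> W (a *: x)).

Lemma gauge_le t x : 0 < t -> W (t^-1%:C *: x) -> gauge W x <= t.
Proof. by move=> t0 Wx; apply: ge_inf => //; exists 0 => s [/ltW]. Qed.

Lemma gauge_has_inf x : has_inf [set t : R | 0 < t /\ W (t^-1%:C *: x)].
Proof.
split; last by exists 0 => s [/ltW].
have [e [B [e0 Bx eB]]] := nbhs_scale0 x W0.
exists (e / 2)^-1; split; first by rewrite invr_gt0 divr_gt0.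
rewrite invrK; apply: eB; last exact: nbhs_singleton.
by rewrite normcR gtr0_norm ?divr_gt0// ltr_pdivrMr//; lra.
Qed.

Lemma gauge_ge0 x : 0 <= gauge W x.
Proof.
by apply: lb_le_inf => [|s [/ltW]//]; have [] := gauge_has_inf x.
Qed.

Lemma gauge_lt t x : gauge W x < t -> W (t^-1%:C *: x).
Proof.
rewrite -subr_gt0 => /inf_adherent/(_ (gauge_has_inf x))[s [s0 Ws]].
rewrite subrKC => st.
have t0 : 0 < t := lt_trans s0 st.
have -> : t^-1%:C *: x = (s / t)%:C *: (s^-1%:C *: x).
  by rewrite scalerA -rmorphM/= mulrAC divff ?mul1r// gt_eqF.
apply: balancedW => //; rewrite normcR gtr0_norm ?divr_gt0//.
by rewrite ler_pdivrMr// mul1r ltW.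
Qed.

Lemma gauge_seminorm : seminorm (gauge W).
Proof.
have gZ (a : R[i]) x : a != 0 -> gauge W (a *: x) <= normc a * gauge W x.
  move=> a0; have na0 := normc_gt0 a0.
  apply/ler_addgt0Pr => e e0; rewrite -(divfK (lt0r_neq0 na0) e).
  rewrite -[e / _ * _]mulrC -mulrDr; set t := _ + _.
  have Wx : W (t^-1%:C *: x) by apply: gauge_lt; rewrite ltrDl divr_gt0.
  have t0 : 0 < t by rewrite ltr_wpDl ?gauge_ge0// divr_gt0.
  apply: gauge_le; first by rewrite mulr_gt0.
  have -> : (normc a * t)^-1%:C *: (a *: x) =
      ((normc a)^-1%:C * a) *: (t^-1%:C *: x).
    by rewrite !scalerA invfM rmorphM/= mulrAC.
  apply: balancedW => //; rewrite normcM normcR.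
  by rewrite gtr0_norm ?invr_gt0// mulVf// gt_eqF.
split=> [x y|a x].
  apply/ler_addgt0Pr => e e0; have e2 : 0 < e / 2 by rewrite divr_gt0.
  rewrite [e]splitr addrACA.
  set s := gauge W x + _; set t := gauge W y + _.
  have s0 : 0 < s by rewrite ltr_wpDl ?gauge_ge0.
  have t0 : 0 < t by rewrite ltr_wpDl ?gauge_ge0.
  have st0 : 0 < s + t by rewrite addr_gt0.
  apply: gauge_le => //.
  have Wx : W (s^-1%:C *: x) by apply: gauge_lt; rewrite ltrDl.
  have Wy : W (t^-1%:C *: y) by apply: gauge_lt; rewrite ltrDl.
  have := @convex_setP W (s / (s + t)) _ _ convexW _ Wx Wy.
  have -> : 1 - s / (s + t) = t / (s + t).
    by rewrite -{1}(divff (lt0r_neq0 st0)) -mulrBl addrC addKr.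
  have cancel (r : R) : 0 < r -> r / (s + t) / r = (s + t)^-1.
    by move=> r0; rewrite mulrAC divff ?mul1r// gt_eqF.
  rewrite !scalerA -!rmorphM/= !cancel// -scalerDr; apply.
  by rewrite ltW ?divr_gt0//= ler_pdivrMr// mul1r lerDl ltW.
have [->|a0] := eqVneq a 0.
  rewrite scale0r normc0 mul0r; apply/eqP.
  rewrite eq_le gauge_ge0 andbT; apply/ler_addgt0Pr => e e0.
  by rewrite add0r; apply: gauge_le; rewrite ?scaler0//; exact: nbhs_singleton.
(* The reverse inequality is [gZ] for the scalar [a^-1] and the vector [a *: x]. *)
apply/eqP; rewrite eq_le gZ//= mulrC.
have na0 := normc_gt0 a0.
rewrite -ler_pdivlMr// mulrC -normcV.
rewrite -{1}[x](scale1r x) -(mulVf a0) -scalerA gZ// invr_eq0//.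
Qed.

End Gauge.

(** Continuity is required at 0 only; translation carries it to every point. *)
Definition continuous_seminorm (p : X -> R) : Prop :=
  seminorm p /\ forall (e : R), 0 < e -> nbhs 0 [set x | p x < e].

(** The balanced core [W] of a convex neighbourhood [U] of 0 is still convex, since scaling commutes
    with convex combinations; the seminorm is its gauge. *)
Lemma nbhs0_seminorm (V : set X) : nbhs 0 V ->
  exists2 p, continuous_seminorm p & forall x, p x < 1 -> V x.
Proof.
move=> V0; have [B Bconvex [Bopen Bbasis]] := @locally_convex _ X.
have [U /= [BU U0] UV] := Bbasis 0 V V0.
pose W := [set x : X | forall a : R[i], normc a <= 1 -> U (a *: x)].
have W0 : nbhs 0 W.
  by apply: nbhs0_balanced; apply: open_nbhs_nbhs; split=> //; exact: Bopen.
have Wbal (a : R[i]) x : normc a <= 1 -> W x -> W (a *: x).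
  move=> a1 Wx b b1; rewrite scalerA; apply: Wx.
  by rewrite normcM mulr_ile1 ?normc_ge0.
have Wconv : convex_set W.
  move=> x y l /set_mem Wx /set_mem Wy; apply/mem_set => a a1.
  rewrite [X in U X](_ : _ = conv l (a *: x : convex_lmodType X)
    (a *: y : convex_lmodType X)).
    apply/set_mem/Bconvex; [exact/mem_set|apply/mem_set; exact: Wx|].
    by apply/mem_set; exact: Wy.
  by rewrite [LHS]scalerDr !scalerA ![a * _]mulrC -!scalerA.
have semip := gauge_seminorm W0 Wconv Wbal.
exists (gauge W); last first.
  move=> x /(gauge_lt W0 Wbal); rewrite invr1 scale1r => /(_ 1).
  by rewrite scale1r normc1 => /(_ (lexx _)); exact: UV.
split=> // e e0.
have e20 : (e / 2)%:C != 0 by rewrite realc_neq0// divr_gt0.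
apply: filterS (nbhs0Z e20 W0) => _ [x Wx <-] /=.
rewrite (seminormZ semip) normcR gtr0_norm ?divr_gt0//.
have : gauge W x <= 1 by apply: gauge_le => //; rewrite invr1 scale1r.
nra.
Qed.


Lemma continuous_seminorm_nbhs (p : X -> R) (x : X) (e : R) :
  continuous_seminorm p -> 0 < e -> nbhs x [set y | p (y - x) < e].
Proof.
move=> [_ pe] /pe/(nbhsT x); apply: filterS => _ [y py <-] /=.
by rewrite addrC addKr.
Qed.

(** * Compactness expressed through seminorms *)

Lemma compact_cluster_sequence (Z : topologicalType) (K : set Z)
    (u : nat -> Z) :
    compact K -> (forall n, K (u n)) ->
  exists2 l, K l & forall A N, nbhs l A -> exists2 n, (N <= n)%N & A (u n).
Proof.
move=> cK Ku; have [|l [Kl ul]] := cK (u @ \oo) _.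
  by exists 0%N => // n _; exact: Ku.
exists l => // A N lA.
have [|_ [[n Nn <-] An]] := ul [set u n | n in [set n | (N <= n)%N]] A _ lA.
  by exists N => // n Nn; exists n.
by exists n.
Qed.

Lemma compact_seminorm_bounded (p : X -> R) (K : set X) :
    continuous_seminorm p -> compact K ->
  exists2 M, 0 < M & forall x, K x -> p x <= M.
Proof.
move=> cp cK; have semip := cp.1; apply: contrapT => noM.
have H n : exists x, K x /\ n.+1%:R < p x.
  apply: contrapT => nox; apply: noM; exists n.+1%:R => // x Kx.
  by rewrite leNgt; apply/negP => ?; apply: nox; exists x.
have [u uP] := choice H.
have [l Kl ul] := compact_cluster_sequence cK (fun n => (uP n).1).
have [n Nn] := ul _ (Num.bound (1 + p l)) (continuous_seminorm_nbhs l cp ltr01).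
move=> /= nl; have [_] := uP n; apply/negP; rewrite -leNgt.
have pl := seminorm_ge0 semip l.
have := archi_boundP (addr_ge0 ler01 pl) => bl.
have nb : (Num.bound (1 + p l))%:R <= n.+1%:R :> R by rewrite ler_nat leqW.
have := seminormD semip (u n - l) l; rewrite subrK.
by move: bl nb; set b := _%:R; set d := n.+1%:R; lra.
Qed.

Section CompactMap.
Context (hausdorffX : hausdorff_space X) (T : {linear X -> X}).
Context (p : X -> R) (cp : continuous_seminorm p).
Context (K : set X) (cK : compact K) (TK : forall x, p x < 1 -> K (T x)).

Lemma compact_map_dominated (q : X -> R) : continuous_seminorm q ->
  exists2 M, 0 < M & forall x, q (T x) <= M * p x.
Proof.
move=> cq; have [semip semiq] := (cp.1, cq.1).
have [M M0 MP] := compact_seminorm_bounded cq cK.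
exists M => // x; apply/ler_addgt0Pr => e e0.
have p0 := seminorm_ge0 semip x.
rewrite -(divfK (lt0r_neq0 M0) e) [_ * M]mulrC -mulrDr.
set s := p x + _; have s0 : 0 < s by rewrite ltr_wpDl// divr_gt0.
have xE : x = s%:C *: (s^-1%:C *: x).
  by rewrite scalerA -rmorphM/= divff ?scale1r// gt_eqF.
rewrite {1}xE linearZ (seminormZ semiq) normcR gtr0_norm// mulrC ler_pM2r//.
apply/MP/TK; rewrite (seminormZ semip) normcR gtr0_norm ?invr_gt0//.
by rewrite mulrC ltr_pdivrMr// mul1r ltrDl divr_gt0.
Qed.

Lemma compact_map_kernel x : p x = 0 -> T x = 0.
Proof.
move=> px; apply: hausdorffX => A B Ax B0.
have [q cq qB] := nbhs0_seminorm B0.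
have [M M0 MP] := compact_map_dominated cq.
exists (T x); split; first exact: nbhs_singleton.
by apply: qB; apply: le_lt_trans (MP x) _; rewrite px mulr0.
Qed.

Lemma compact_map_sequence (m : nat -> R[i]) (x : nat -> X) :
    (forall n, normc (m n) <= 1) -> (forall n, p (x n) <= 1) ->
  exists mu w, normc mu <= 1 /\ forall (e : R) N, 0 < e ->
    exists n, [/\ (N <= n)%N, normc (m n - mu) < e & p (T (x n) - w) < e].
Proof.
move=> m1 x1; have semip := cp.1.
pose I := `[-1, 1]%classic : set R.
have cI := @segment_compact R (-1) 1.
(* Scalars and images converge together in a product of compact sets. Halving [x n] is needed
   because [K] only catches images of the open unit ball. *)
pose u n := (complex.Re (m n), complex.Im (m n), T (2^-1%:C *: x n)).
have Ku n : ((I `*` I) `*` K) (u n).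
  have re : `|complex.Re (m n)| <= 1 := le_trans (normr_Re_le _) (m1 n).
  have im : `|complex.Im (m n)| <= 1 := le_trans (normr_Im_le _) (m1 n).
  split; first by split; rewrite /I/= in_itv/= -ler_norml.
  apply: TK; rewrite (seminormZ semip) normcR gtr0_norm ?invr_gt0//.
  by have := x1 n; lra.
have [[[a b] l] _ ul] :=
  compact_cluster_sequence (compact_setX (compact_setX cI cI) cK) Ku.
have freq (e : R) N : 0 < e -> exists n,
    [/\ (N <= n)%N, normc (m n - Complex a b) < e
      & p (T (x n) - 2%:C *: l) < e].
  move=> e0; have e2 : 0 < e / 2 by rewrite divr_gt0.
  have [|n Nn [[/= na nb] nl]] := ul
      ((ball a (e / 2) `*` ball b (e / 2)) `*` [set y | p (y - l) < e / 2]) N.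
    exists (ball a (e / 2) `*` ball b (e / 2),
      [set y | p (y - l) < e / 2]) => //.
    split; last exact: continuous_seminorm_nbhs.
    by exists (ball a (e / 2), ball b (e / 2)) => //; split; exact: nbhsx_ballx.
  exists n; split=> //.
    apply: le_lt_trans (normc_le _) _; rewrite [e]splitr ltrD//.
      by move: na; rewrite -ball_normE/= distrC; case: (m n).
    by move: nb; rewrite -ball_normE/= distrC; case: (m n).
  have -> : T (x n) - 2%:C *: l = 2%:C *: (T (2^-1%:C *: x n) - l).
    rewrite [T (_ *: _)]linearZ/= scalerBr scalerA -rmorphM/= divff// scale1r.
    by [].
  rewrite (seminormZ semip) normcR gtr0_norm//; lra.
exists (Complex a b), (2%:C *: l); split; last exact: freq.
apply/ler_addgt0Pr => e e0; have [n [_ ne _]] := freq e 0%N e0.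
rewrite -[Complex a b](subKr (m n)); apply: le_trans (le_normcD _ _) _.
by rewrite normcN lerD// ltW.
Qed.

End CompactMap.

End ContinuousSeminorms.

(** * Continuity and resolvents *)

Lemma bounded_continuous (R : realType) (X : tvsType R[i]) (p : X -> R)
    (f : {linear X -> X}) :
    continuous_seminorm p ->
    (forall q, continuous_seminorm q ->
      exists2 M, 0 < M & forall x, q (f x) <= M * p x) ->
  continuous f.
Proof.
move=> cp fq x A Ax.
have V0 : nbhs 0 (+%R (- f x) @` A).
  by have := nbhsB (- f x) Ax; rewrite addNr.
have [q cq qV] := nbhs0_seminorm V0; have [M M0 fM] := fq q cq.
have M10 : 0 < M^-1 by rewrite invr_gt0.
apply: filterS (continuous_seminorm_nbhs x cp M10) => y /= yx.
have [z Az zE] : (+%R (- f x) @` A) (f (y - x)).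
  by apply: qV; apply: le_lt_trans (fM _) _; rewrite -ltr_pdivlMl// mulr1.
suff <- : z = f y by [].
by apply: (addrI (- f x)); rewrite zE linearB/= addrC.
Qed.

(** [1 - mu T] is [mu] times [mu^-1 - T]. *)
Lemma resolvent_solution (R : realType) (X : tvsType R[i]) (T : {linear X -> X})
    (mu : R[i]) (y : X) : mu != 0 -> ~ spectrum T mu^-1 ->
  exists2 x, x - mu *: T x = y & forall z, z - mu *: T z = y -> z = x.
Proof.
move=> mu0 /contrapT[S [_ KS SK]]; exists (S (mu^-1 *: y)) => [|z zy].
  have := SK (mu^-1 *: y) => /(congr1 ( *:%R mu)).
  by rewrite scalerBr !scalerA divff// !scale1r.
by rewrite -[LHS]KS -zy scalerBr scalerA mulVf// scale1r.
Qed.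

Lemma closed_ball_normc (R : realType) (d : R) (z : R[i]) :
  0 <= d -> closed_ball (0 : R[i]^o) d%:C z -> normc z <= d.
Proof.
move=> d0 zd; rewrite leNgt; apply/negP => dz.
have e0 : 0 < (normc z - d)%:C.
  by rewrite -(rmorph0 (real_complex R)) ltcR subr_gt0.
have [w []] := zd _ (nbhsx_ballx (z : R[i]^o) _ e0).
rewrite -!ball_normE/= sub0r normrN !ltcR => wd zw.
by have := le_normcD (z - w) w; rewrite subrK; lra.
Qed.

(** * Power boundedness and convergence of the Cesaro means *)

Unset Implicit Arguments.

Theorem theorem6p4 (R : realType) (X : tvsType R[i])
    (hausdorffX : hausdorff_space X)
    (locally_completeX : locally_complete X)
    (webbedX : webbed X)
    (ultrabornologicalX : ultrabornological X)
    (T : {linear X -> X}) (continuousT : continuous T)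
    (compactT : compact_operator T)
    (spectrum1 : 1 \in spectrum T)
    (delta : R) (delta01 : 0 < delta < 1)
    (spectrumT : spectrum T `\ 1 `<=` closed_ball (0 : R[i]^o) delta%:C)
    (kernel_range :
      [set x | x - T x = 0] `&` range (fun x => x - T x) = [set 0]) :
  power_bounded T /\ uniformly_mean_ergodic T.
Proof.
have [U U0 cTU] := compactT.
have [p cp pU] := nbhs0_seminorm U0; have semip := cp.1.
rewrite precompactE in cTU.
have TK x : p x < 1 -> closure (T @` U) (T x).
  by move=> /pU Ux; apply: subset_closure; exists x.
have dom := compact_map_dominated cp cTU TK.
have [c0 c0_gt0 pT] := dom p cp.
have range_kernel x : T x = x -> range (fun x => x - T x) x -> x = 0.
  move=> Tx Yx; have : ([set x | x - T x = 0] `&` range (fun x => x - T x)) x.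
    by split=> //=; rewrite Tx subrr.
  by rewrite kernel_range.
(* [mu^-1] differs from 1 and has modulus at least 1, which exceeds [delta]. *)
have notspec mu : normc mu <= 1 -> mu != 1 -> mu != 0 -> ~ spectrum T mu^-1.
  case/andP: delta01 => delta0 delta1 mu1 mu1E mu0 specmu.
  have /(closed_ball_normc (ltW delta0)) :
      closed_ball (0 : R[i]^o) delta%:C mu^-1.
    apply: spectrumT; split=> //= /(congr1 GRing.inv).
    by rewrite invrK invr1; exact/eqP.
  rewrite normcV leNgt => /negP; apply.
  by apply: lt_le_trans delta1 _; rewrite invf_ge1// normc_gt0.
have solve mu y : normc mu <= 1 -> mu != 1 ->
    exists2 x, x - mu *: T x = y & forall z, z - mu *: T z = y -> z = x.
  move=> mu1 mu1E; have [->|mu0] := eqVneq mu 0.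
    by exists y => [|z]; rewrite scale0r subr0.
  exact/resolvent_solution/notspec.
have [||P [C [C0 PC]]] := riesz_projection semip (ltW c0_gt0) pT
    (compact_map_kernel hausdorffX cp cTU TK)
    (compact_map_sequence cp cTU TK) range_kernel.
- move=> mu x mu1 mu1E xmu; have [z _ zP] := solve mu 0 mu1 mu1E.
  rewrite (zP _ xmu) -(zP 0)// linear0 scaler0 subr0//.
- by move=> mu y mu1 mu1E; have [x xy _] := solve mu y mu1 mu1E; exists x.
have TP n x : iter n T (P x) = P x.
  by elim: n => //= n ->; have [] := PC x.
have iterE x w n : x - P x = w - T w ->
    iter n T x = P x + (iter n T w - iter n.+1 T w).
  move=> xw; have {1}-> : x = P x + (w - T w) by rewrite -xw subrKC.
  rewrite [iter n T (_ + _)]linearD/= TP [iter n T (_ - _)]linearB/=.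
  by rewrite -iterS iterSr.
have pP x : p (P x) <= (1 + 2 * C) * p x.
  have [_ [w xw wC]] := PC x; rewrite -[P x](subKr x) xw.
  have := seminormB semip x (w - T w); have := seminormB semip w (T w).
  by have := wC 0%N; have := wC 1%N; rewrite /=; lra.
have pTn n x : p (iter n T x) <= (1 + 4 * C) * p x.
  have [_ [w xw wC]] := PC x; rewrite (iterE _ _ _ xw).
  have := seminormD semip (P x) (iter n T w - iter n.+1 T w).
  have := seminormB semip (iter n T w) (iter n.+1 T w).
  by have := wC n; have := wC n.+1; have := pP x; lra.
(* The powers are controlled in [p] only; one further application of [T] passes from [p] to an
   arbitrary [q], hence the exponent [n.+1]. *)
have domP q : continuous_seminorm q -> exists2 M, 0 < M &
    forall n x, q (iter n.+1 T x) <= M * p x.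
  move=> /dom[M M0 MP]; exists (M * (1 + 4 * C)) => [|n x].
    by rewrite mulr_gt0// ltr_wpDr// mulr_ge0.
  by apply: le_trans (MP _) _; rewrite -mulrA ler_wpM2l ?(ltW M0) ?pTn.
split.
  move=> x V V0; have [q cq qV] := nbhs0_seminorm V0.
  have [M M0 MP] := domP q cq.
  have e0 : 0 < M^-1 by rewrite invr_gt0.
  apply: filterS (continuous_seminorm_nbhs x cp e0) => y /= yx _ [[//|n] _ <-].
  rewrite -[_ - _](linearB (iter n.+1 T)); apply: qV.
  by apply: le_lt_trans (MP _ _) _; rewrite -ltr_pdivlMl// mulr1.
exists P.
  apply: (bounded_continuous cp) => q cq; have [M M0 MP] := dom q cq.
  exists (M * (1 + 2 * C)) => [|x].
    by rewrite mulr_gt0// ltr_wpDr// mulr_ge0.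
  by rewrite -(TP 1%N) -mulrA (le_trans (MP _))// ler_wpM2l ?(ltW M0) ?pP.
move=> Q [[B V] /= [bB V0] BVQ].
have [q cq qV] := nbhs0_seminorm V0; have [M M0 MP] := domP q cq.
have semiq := cq.1.
(* Boundedness of [B] enters only through its absorption by the unit ball of [p]. *)
have [r r0 Br] := bB _ (cp.2 _ ltr01).
have Bp x : B x -> p x <= r.
  move=> /Br[v /= pv <-]; rewrite (seminormZ semip) normcR gtr0_norm//.
  by rewrite ler_piMr// ltW.
have K0 : 0 < M * (2 * C * r) + 1.
  by rewrite ltr_wpDl// !mulr_ge0// ltW.
have [|N NP] := @invSn_small _ (M * (2 * C * r) + 1)^-1.
  by rewrite invr_gt0.
exists N.+1 => // -[//|n] /= Nn; apply: BVQ => x Bx; apply: qV.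
have [_ [w xw wC]] := PC x.
(* By [iterE] the sum telescopes. What remains is [T] of a vector with [p] at most [2 * C * r] on
   [B], so dividing by [n.+1] gives uniform convergence on [B]. *)
have -> : cesaro_mean T n.+1 x - P x = n.+1%:R^-1 *: (T w - T (iter n.+1 T w)).
  rewrite /cesaro_mean; apply/eqP; rewrite subr_eq; apply/eqP.
  have -> k : \sum_(1 <= m < k.+1) iter m T x =
      (T w - T (iter k T w)) + k%:R *: P x.
    elim: k => [|k IHk]; first by rewrite big_geq// subrr scale0r addr0.
    rewrite big_nat_recr// IHk (iterE _ _ k.+1 xw)/= [P x + _]addrC.
    by rewrite addrACA subrKA -addn1 natrD scalerDl scale1r.
  by rewrite scalerDr scalerA mulVf ?pnatr_eq0// scale1r.
rewrite (seminormZ semiq) normcV normc_nat -linearB.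
have pw : p (w - iter n.+1 T w) <= 2 * C * r.
  apply: le_trans (seminormB semip _ _) _.
  have := wC 0%N; have := wC n.+1; have := Bp x Bx => /= h1 h2 h3.
  have h4 : C * p x <= C * r by rewrite ler_wpM2l.
  lra.
have := MP 0%N (w - iter n.+1 T w); rewrite /= => MPw.
apply: le_lt_trans (_ : n.+1%:R^-1 * (M * (2 * C * r)) < 1).
  rewrite ler_wpM2l// ?invr_ge0//; apply: le_trans MPw _.
  by rewrite ler_wpM2l ?(ltW M0) ?pw.
rewrite mulrC ltr_pdivrMr// mul1r.
have /ltW := NP _ (Nn : (N <= n)%N).
rewrite lef_pV2 ?posrE// => h; apply: lt_le_trans h.
by rewrite ltrDl.
Qed.
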